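(* Let $k$ be a field of characteristic $0$, let $\Psi_0=(B,\delta_0,h_0)$ be a CDG-algebra over $k$, let $C=B/[B,B]$ with projection $T\colon B\to C$ and induced differential $\delta_C$, and put $c_n=T(h_0^n)\in C^{2n}$ for $n\ge1$. Then: a) $\delta_C(c_n)=0$; b) the cohomology class of $c_n$ in $H^{2n}(C,\delta_C)$ does not change when the CDG-algebra $\Psi_0$ is replaced by an equivalent one; that is, for every $\alpha\in B^1$, with $h(\alpha)=h_0+\delta_0\alpha+\alpha^2$, the elements $T(h_0^n)$ and $T(h(\alpha)^n)$ define the same class in $H^{2n}(C,\delta_C)$.
   Context: Algebras are associative with unit; graded algebras are locally finite-dimensional. $[a,b]=ab-(-1)^{\tilde a\tilde b}ba$ is the supercommutator. A CDG-algebra is a triple $(B,\delta_0,h_0)$ with $B$ a graded algebra, $B^i=0$ for $i<0$, $\delta_0$ a derivation of degree $+1$ ($\delta_0(ab)=\delta_0(a)b+(-1)^{\tilde a}a\delta_0(b)$), $h_0\in B^2$, such that $\delta_0^2=[h_0,\cdot\,]$ and $\delta_0(h_0)=0$. The CDG-algebras equivalent to $(B,\delta_0,h_0)$ are those of the form $(B,\ \delta_0+[\alpha,\cdot\,],\ h_0+\delta_0\alpha+\alpha^2)$ with $\alpha\in B^1$. $[B,B]$ is the linear subspace of $B$ spanned by all supercommutators; $C=B/[B,B]$ is a graded vector space. The operator $\delta_C$ on $C$ induced by $\delta_0$ is well defined, satisfies $\delta_C^2=0$, and is the same for equivalent CDG-algebras. *)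

(* Defs.v *)
From HB Require Import structures.
From mathcomp Require Import all_boot all_order all_algebra.
From mathcomp Require Import boolp.

Set Implicit Arguments.
Unset Strict Implicit.
Unset Printing Implicit Defensive.

Import GRing.Theory.
Local Open Scope ring_scope.

(* ring_quotient only provides the zmodType structure of such a quotient. *)
Section QuotientModule.
Variables (k : pzRingType) (V : lmodType k) (S : {pred V}).
Hypothesis S_submod : submod_closed S.

Let S_isZmodClosed :=
  GRing.isZmodClosed.Build V S (GRing.submod_closedB S_submod).
Definition zmod_of_submod : zmodClosed V :=
  HB.pack_for (zmodClosed V) S S_isZmodClosed.

Definition quotmod : Type := Quotient.quot zmod_of_submod.
HB.instance Definition _ := GRing.Zmodule.on quotmod.

Definition quot_proj (x : V) : quotmod := (\pi_(Quotient.quot zmod_of_submod) x)%qT.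

Lemma quot_proj_eq x y : (quot_proj x = quot_proj y) <-> (x - y \in S).
Proof.
rewrite (Quotient.idealrBE zmod_of_submod x y).
by split=> [/eqP//|/eqP].
Qed.

Definition quot_repr (x : quotmod) : V := repr (x : Quotient.quot zmod_of_submod).

Lemma quot_reprK : cancel quot_repr quot_proj.
Proof. exact: reprK. Qed.

Lemma quot_proj_is_zmod_morphism : zmod_morphism quot_proj.
Proof. by move=> x y; rewrite /quot_proj raddfB. Qed.

HB.instance Definition _ :=
  GRing.isZmodMorphism.Build V quotmod quot_proj quot_proj_is_zmod_morphism.

Definition quot_scale (a : k) (x : quotmod) : quotmod :=
  quot_proj (a *: quot_repr x).

Lemma quot_scale_proj a x : quot_scale a (quot_proj x) = quot_proj (a *: x).
Proof.
apply/quot_proj_eq; rewrite -scalerBr -[_ *: _]addr0.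
case: S_submod => S0; apply=> //.
by apply/quot_proj_eq; rewrite quot_reprK.
Qed.

Lemma quot_scalerA a b v : quot_scale a (quot_scale b v) = quot_scale (a * b) v.
Proof. by rewrite -[v]quot_reprK !quot_scale_proj scalerA. Qed.
Lemma quot_scale1r : left_id 1 quot_scale.
Proof. by move=> v; rewrite -[v]quot_reprK quot_scale_proj scale1r. Qed.
Lemma quot_scalerDr : right_distributive quot_scale +%R.
Proof.
move=> a u v; rewrite -[u]quot_reprK -[v]quot_reprK -raddfD !quot_scale_proj.
by rewrite scalerDr raddfD.
Qed.
Lemma quot_scalerDl v : {morph quot_scale^~ v : a b / a + b}.
Proof.
by move=> a b /=; rewrite -[v]quot_reprK !quot_scale_proj scalerDl raddfD.
Qed.

HB.instance Definition _ := GRing.Zmodule_isLmodule.Build k quotmod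
  quot_scalerA quot_scale1r quot_scalerDr quot_scalerDl.

Lemma quot_proj_is_scalable : scalable quot_proj.
Proof. by move=> a x; rewrite -quot_scale_proj. Qed.

HB.instance Definition _ :=
  GRing.isScalable.Build k V quotmod *:%R quot_proj quot_proj_is_scalable.

End QuotientModule.

(* An associative unital k-algebra B = \bigoplus_(i >= 0) B^i with every B^i
   finite dimensional.  The direct sum decomposition is given by its projections
   gr_proj i : B -> B, and B^i = [b | gr_proj i b = b].  MathComp algebras are
   nontrivial rings; the product is given on a left module instead, so that the
   zero algebra is allowed. *)
Record gradedAlg (k : fieldType) := GradedAlg {
  gr_mod : lmodType k;
  gr_mul : gr_mod -> gr_mod -> gr_mod;
  gr_one : gr_mod;
  gr_mulA : associative gr_mul;
  gr_mul1l : left_id gr_one gr_mul;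
  gr_mul1r : right_id gr_one gr_mul;
  gr_mul_linl : forall b, linear (gr_mul^~ b);
  gr_mul_linr : forall a, linear (gr_mul a);
  gr_proj : nat -> {linear gr_mod -> gr_mod};
  gr_proj_orth : forall i j b,
    gr_proj i (gr_proj j b) = if i == j then gr_proj i b else 0;
  gr_proj_sum : forall b, exists n, b == \sum_(i < n) gr_proj i b;
  gr_one_deg : gr_proj 0 gr_one = gr_one;
  gr_mul_deg : forall i j a b, gr_proj i a = a -> gr_proj j b = b ->
    gr_proj (i + j) (gr_mul a b) = gr_mul a b;
  gr_locfin : forall i, exists d (e : 'I_d -> gr_mod),
    forall b, gr_proj i b = b -> exists c : 'I_d -> k, b = \sum_j c j *: e j
}.

Definition gr_sort (k : fieldType) (B : gradedAlg k) : Type := gr_mod B.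
Coercion gr_sort : gradedAlg >-> Sortclass.

HB.instance Definition _ (k : fieldType) (B : gradedAlg k) :=
  GRing.Lmodule.on (gr_sort B).

Section RingStructure.
Variables (k : fieldType) (B : gradedAlg k).

Fact gr_mulDl : left_distributive (@gr_mul k B) +%R.
Proof. by move=> a b c; have := gr_mul_linl c 1 a b; rewrite !scale1r. Qed.
Fact gr_mulDr : right_distributive (@gr_mul k B) +%R.
Proof. by move=> a b c; have := gr_mul_linr a 1 b c; rewrite !scale1r. Qed.

HB.instance Definition _ := GRing.Zmodule_isPzRing.Build (gr_sort B)
  (@gr_mulA k B) (@gr_mul1l k B) (@gr_mul1r k B) gr_mulDl gr_mulDr.

Lemma gr_scalerAl (c : k) (a b : B) : c *: (a * b) = (c *: a) * b.
Proof.
have e : (c *: a + 0) * b = c *: (a * b) + 0 * b := gr_mul_linl b c a 0.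
by rewrite addr0 mul0r addr0 in e; rewrite e.
Qed.
Lemma gr_scalerAr (c : k) (a b : B) : c *: (a * b) = a * (c *: b).
Proof.
have e : a * (c *: b + 0) = c *: (a * b) + a * 0 := gr_mul_linr a c b 0.
by rewrite addr0 mulr0 addr0 in e; rewrite e.
Qed.
End RingStructure.

Section GradedAlgebra.
Variables (k : fieldType) (B : gradedAlg k).
Implicit Types (a b : B).

Definition gr_pr i : {linear B -> B} := gr_proj B i.

Lemma gr_pr_orth i j b : gr_pr i (gr_pr j b) = if i == j then gr_pr i b else 0.
Proof. exact: gr_proj_orth. Qed.

Definition homog (i : nat) b : Prop := gr_pr i b = b.

Definition gr_bound b : nat := ex_minn (gr_proj_sum b).

(* The supercommutator, extended bilinearly from homogeneous elements
   (see scommE). *)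
Definition scomm a b : B :=
  \sum_(i < gr_bound a) \sum_(j < gr_bound b)
     (gr_pr i a * gr_pr j b - (-1) ^+ (i * j) *: (gr_pr j b * gr_pr i a)).

Lemma gr_boundE b : b = \sum_(i < gr_bound b) gr_pr i b.
Proof. by rewrite /gr_bound; case: ex_minnP => n /eqP. Qed.

Lemma gr_pr0 b i : (gr_bound b <= i)%N -> gr_pr i b = 0.
Proof.
move=> le_i; rewrite [b in LHS]gr_boundE linear_sum big1 // => j _.
by rewrite gr_pr_orth gtn_eqF // (leq_trans (ltn_ord j)).
Qed.

Lemma homog_pr i b : homog i (gr_pr i b).
Proof. by rewrite /homog gr_pr_orth eqxx. Qed.

Lemma homog_neq i j b : homog i b -> j != i -> gr_pr j b = 0.
Proof. by move=> <- /negPf ne; rewrite gr_pr_orth ne. Qed.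

Lemma sum_widen (V : zmodType) (F : nat -> V) n N :
  (n <= N)%N -> (forall i, (n <= i)%N -> F i = 0) ->
  \sum_(i < n) F i = \sum_(i < N) F i.
Proof.
move=> leN F0; rewrite -(big_mkord xpredT F) -(big_mkord xpredT F).
rewrite (@big_cat_nat _ _ _ n 0 N) //= [X in _ + X]big1_seq ?addr0 // => i.
by rewrite mem_index_iota => /andP[_ /andP[? _]]; apply: F0.
Qed.

Lemma scomm_widen a b N M : (gr_bound a <= N)%N -> (gr_bound b <= M)%N ->
  scomm a b = \sum_(i < N) \sum_(j < M)
     (gr_pr i a * gr_pr j b - (-1) ^+ (i * j) *: (gr_pr j b * gr_pr i a)).
Proof.
move=> leN leM; rewrite /scomm.
rewrite (@sum_widen _ (fun i => \sum_(j < gr_bound b)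
     (gr_pr i a * gr_pr j b - (-1) ^+ (i * j) *: (gr_pr j b * gr_pr i a))) _ N)
  //; last first.
  move=> i lei; rewrite big1 // => j _.
  by rewrite (gr_pr0 lei) mul0r mulr0 scaler0 subrr.
apply: eq_bigr => i _.
apply: (@sum_widen _ (fun j => gr_pr i a * gr_pr j b -
  (-1) ^+ (i * j) *: (gr_pr j b * gr_pr i a)) _ M) => // j lej.
by rewrite (gr_pr0 lej) mul0r mulr0 scaler0 subrr.
Qed.

Lemma scommE i j a b : homog i a -> homog j b ->
  scomm a b = a * b - (-1) ^+ (i * j) *: (b * a).
Proof.
move=> ha hb.
rewrite (@scomm_widen a b (maxn (gr_bound a) i.+1) (maxn (gr_bound b) j.+1))
   ?leq_maxl //.
have li : (i < maxn (gr_bound a) i.+1)%N by rewrite leq_maxr.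
have lj : (j < maxn (gr_bound b) j.+1)%N by rewrite leq_maxr.
rewrite (bigD1 (Ordinal li)) //= [X in _ + X]big1 ?addr0; last first.
  move=> i' ne; rewrite big1 // => j' _.
  by rewrite (homog_neq ha ne) mul0r mulr0 scaler0 subrr.
rewrite (bigD1 (Ordinal lj)) //= [X in _ + X]big1 ?addr0 ?ha ?hb //.
by move=> j' ne; rewrite (homog_neq hb ne) mul0r mulr0 scaler0 subrr.
Qed.

Fact scomm_is_linear a : linear (scomm a).
Proof.
move=> c x y.
pose M := maxn (gr_bound (c *: x + y)) (maxn (gr_bound x) (gr_bound y)).
have lex : (gr_bound x <= M)%N by rewrite /M !leq_max leqnn !orbT.
have ley : (gr_bound y <= M)%N by rewrite /M !leq_max leqnn !orbT.
have lexy : (gr_bound (c *: x + y)%R <= M)%N by rewrite /M !leq_max leqnn.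
rewrite (scomm_widen (leqnn _) lex) (scomm_widen (leqnn _) ley).
rewrite (scomm_widen (leqnn _) lexy) scaler_sumr -big_split /=.
apply: eq_bigr => i _; rewrite scaler_sumr -big_split /=.
apply: eq_bigr => j _; rewrite linearP mulrDr mulrDl -gr_scalerAr -gr_scalerAl.
by rewrite scalerDr opprD scalerBr !scalerA [c * _]mulrC addrACA.
Qed.

HB.instance Definition _ a :=
  GRing.isLinear.Build k B B *:%R (scomm a) (scomm_is_linear a).

Lemma homog_ind (P : B -> Prop) : P 0 -> (forall a b, P a -> P b -> P (a + b)) ->
  (forall i b, homog i b -> P b) -> forall b, P b.
Proof.
move=> P0 PD Ph b; rewrite [b]gr_boundE.
by apply: (big_ind P) => // i _; apply: Ph (homog_pr _ _).
Qed.

Lemma homogD i a b : homog i a -> homog i b -> homog i (a + b).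
Proof. by rewrite /homog linearD => -> ->. Qed.
Lemma homogZ i c b : homog i b -> homog i (c *: b).
Proof. by rewrite /homog linearZ => /= ->. Qed.
Lemma homogM i j a b : homog i a -> homog j b -> homog (i + j) (a * b).
Proof. exact: gr_mul_deg. Qed.
Lemma homog0 i : homog i (0 : B).
Proof. by rewrite /homog linear0. Qed.

Lemma homog_scomm i j a b : homog i a -> homog j b -> homog (i + j) (scomm a b).
Proof.
move=> ha hb; rewrite (scommE ha hb) -scaleNr.
by apply: homogD; [exact: homogM | rewrite addnC; apply/homogZ/homogM].
Qed.

Definition comm_space : {pred B} := fun b =>
  `[< exists s : seq (k * B * B), b = \sum_(p <- s) p.1.1 *: scomm p.1.2 p.2 >].

Lemma comm_space_scomm a b : scomm a b \in comm_space.
Proof. by apply/asboolP; exists [:: (1, a, b)]; rewrite big_seq1 scale1r. Qed.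

Fact comm_space_submod : submod_closed comm_space.
Proof.
split=> [|c x y /asboolP[s ->] /asboolP[t ->]]; apply/asboolP.
  by exists [::]; rewrite big_nil.
exists ([seq (c * p.1.1, p.1.2, p.2) | p <- s] ++ t).
rewrite big_cat big_map /= scaler_sumr.
by congr (_ + _); apply: eq_bigr => p _; rewrite scalerA.
Qed.

Definition Cquot : Type := quotmod comm_space_submod.
HB.instance Definition _ := GRing.Lmodule.on Cquot.

Definition Tproj (b : B) : Cquot := quot_proj comm_space_submod b.
HB.instance Definition _ := GRing.Linear.copy Tproj (quot_proj comm_space_submod).

(* x lies in C^m, the image of B^m *)
Definition Cdeg (m : nat) (x : Cquot) : Prop := exists2 b, homog m b & Tproj b = x.

(* x lies in C^(m-1), where C^(-1) = 0 *)
Definition Cdeg_pred (m : nat) (x : Cquot) : Prop :=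
  if m is p.+1 then Cdeg p x else x = 0.

Lemma Cdeg_lin m c x y : Cdeg m x -> Cdeg m y -> Cdeg m (c *: x + y).
Proof.
move=> [a ha <-] [b hb <-]; exists (c *: a + b); last by rewrite linearP.
by apply: homogD => //; apply: homogZ.
Qed.
Lemma Cdeg0 m : Cdeg m 0.
Proof. by exists 0; [exact: homog0 | rewrite linear0]. Qed.

Lemma Cdeg_pred_lin m c x y :
  Cdeg_pred m x -> Cdeg_pred m y -> Cdeg_pred m (c *: x + y).
Proof.
case: m => [/= -> ->|m]; first by rewrite scaler0 addr0.
exact: Cdeg_lin.
Qed.
Lemma Cdeg_pred0 m : Cdeg_pred m 0.
Proof. by case: m => //= m; apply: Cdeg0. Qed.

End GradedAlgebra.

Arguments gr_pr {k B} i.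
Arguments comm_space {k B}.
Arguments Tproj {k B}.

Record cdg (k : fieldType) (B : gradedAlg k) := Cdg {
  cdg_d : {linear B -> B};
  cdg_h : B;
  cdg_d_deg : forall i b, homog i b -> homog i.+1 (cdg_d b);
  cdg_d_der : forall i a b, homog i a ->
    cdg_d (a * b) = cdg_d a * b + (-1) ^+ i *: (a * cdg_d b);
  cdg_h_deg : homog 2 cdg_h;
  cdg_d_sq : forall b, cdg_d (cdg_d b) = scomm cdg_h b;
  cdg_d_h : cdg_d cdg_h = 0
}.

Section Twist.
Variables (k : fieldType) (B : gradedAlg k) (Psi : cdg B) (alpha : B).
Hypothesis alpha1 : homog 1 alpha.
Local Notation d := (cdg_d Psi).
Local Notation h := (cdg_h Psi).

Definition twist_d : {linear B -> B} := d \+ scomm alpha.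
Definition twist_h : B := h + d alpha + alpha ^+ 2.

Lemma twist_dE b : twist_d b = d b + scomm alpha b. Proof. by []. Qed.

Lemma scomm1E j b : homog j b ->
  scomm alpha b = alpha * b - (-1) ^+ j *: (b * alpha).
Proof. by move=> hb; rewrite (scommE alpha1 hb) mul1n. Qed.

Fact twist_d_deg i b : homog i b -> homog i.+1 (twist_d b).
Proof.
move=> hb; rewrite twist_dE; apply: homogD; first exact: cdg_d_deg.
by rewrite -add1n; apply: homog_scomm.
Qed.

Fact twist_d_der i a b : homog i a ->
  twist_d (a * b) = twist_d a * b + (-1) ^+ i *: (a * twist_d b).
Proof.
move=> ha; rewrite !twist_dE (cdg_d_der _ _ ha) mulrDl mulrDr scalerDr.
rewrite addrACA; congr (_ + _).
elim/(@homog_ind k B): b => [|b b' IH IH'|j b hb].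
- by rewrite !(mulr0, linear0) addr0.
- by rewrite mulrDr linearD /= IH IH' linearD !mulrDr scalerDr addrACA.
rewrite (scomm1E (homogM ha hb)) (scomm1E ha) (scomm1E hb).
rewrite mulrBl mulrBr scalerBr -gr_scalerAl -gr_scalerAr scalerA -exprD.
by rewrite !mulrA addrA subrK.
Qed.

Fact twist_h_deg : homog 2 twist_h.
Proof.
rewrite /twist_h; apply: homogD; last by apply: (homogM (i := 1) (j := 1)).
by apply: homogD; [exact: cdg_h_deg | exact: cdg_d_deg].
Qed.

Fact twist_d_sq b : twist_d (twist_d b) = scomm twist_h b.
Proof.
elim/(@homog_ind k B): b => [|b b' IH IH'|j b hb].
- by rewrite !linear0.
- have twD x y : twist_d (x + y) = twist_d x + twist_d y by exact: linearD.
  by rewrite (twD b b') (twD (twist_d b)) IH IH' linearD.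
have hdb := cdg_d_deg Psi hb.
have hab := homogM alpha1 hb; have hba := homogM hb alpha1.
have signS n : (-1) ^+ n.+1 = - (-1) ^+ n :> k by rewrite exprS mulN1r.
have sgn2 : (-1) ^+ j * (-1) ^+ j = 1 :> k by rewrite -expr2 sqrr_sign.
have E1 : d (scomm alpha b) =
    d alpha * b - alpha * d b - (-1) ^+ j *: (d b * alpha) - b * d alpha.
  rewrite (scomm1E hb) linearB linearZ /= (cdg_d_der Psi _ alpha1).
  rewrite (cdg_d_der Psi _ hb) expr1 scaleN1r scalerDr scalerA sgn2 scale1r.
  by rewrite opprD addrA.
have E2 : scomm alpha (d b) = alpha * d b + (-1) ^+ j *: (d b * alpha).
  by rewrite (scomm1E hdb) signS scaleNr opprK.
have E3 : scomm alpha (scomm alpha b) = alpha ^+ 2 * b - b * alpha ^+ 2.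
  rewrite (scomm1E hb) linearB linearZ /= (scomm1E hab) (scomm1E hba).
  rewrite addn1 add1n signS !scaleNr !opprK scalerDr scalerA sgn2 scale1r.
  by rewrite !expr2 !mulrA opprD addrA addrK.
have E0 : scomm twist_h b =
    h * b - b * h + (d alpha * b - b * d alpha)
    + (alpha ^+ 2 * b - b * alpha ^+ 2).
  rewrite (scommE twist_h_deg hb) mul2n -signr_odd odd_double scale1r.
  by rewrite /twist_h !mulrDl !mulrDr !opprD [in LHS]addrACA [X in X + _]addrACA.
rewrite E0 !twist_dE !linearD /= cdg_d_sq (scommE (cdg_h_deg Psi) hb).
rewrite mul2n -signr_odd odd_double scale1r E1 E2 E3.
rewrite -!addrA; do 2!congr (_ + _).
move: (d alpha * b) (alpha * d b) (_ *: _) (b * d alpha) (_ - _).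
move=> P t1 t2 Q Y; congr (_ + _).
by rewrite (addrCA (- Q) t1) (addrCA (- Q) t2) (addrCA (- t2) t1) !addKr.
Qed.

Fact twist_d_h : twist_d twist_h = 0.
Proof.
have hda := cdg_d_deg Psi alpha1.
have haa : homog 2 (alpha * alpha) := homogM alpha1 alpha1.
have E1 : scomm h alpha = h * alpha - alpha * h.
  by rewrite (scommE (cdg_h_deg Psi) alpha1) sqrrN expr1n scale1r.
have E2 : d (alpha * alpha) = d alpha * alpha - alpha * d alpha.
  by rewrite (cdg_d_der _ _ alpha1) expr1 scaleN1r.
have E3 : scomm alpha h = alpha * h - h * alpha.
  by rewrite (scomm1E (cdg_h_deg Psi)) sqrrN expr1n scale1r.
have E4 : scomm alpha (d alpha) = alpha * d alpha - d alpha * alpha.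
  by rewrite (scomm1E hda) sqrrN expr1n scale1r.
have E5 : scomm alpha (alpha * alpha) = 0.
  by rewrite (scomm1E haa) sqrrN expr1n scale1r mulrA subrr.
rewrite twist_dE /twist_h expr2 !linearD /= cdg_d_h add0r cdg_d_sq.
rewrite E1 E2 E3 E4 E5 addr0 addrACA -[alpha * h - _]opprB addrN add0r.
by rewrite -[alpha * d _ - _]opprB addrN.
Qed.

(* The equivalent CDG-algebra
   (B, delta_0 + [alpha, .], h_0 + delta_0 alpha + alpha^2) for alpha in B^1. *)
Definition twist : cdg B :=
  Cdg twist_d_deg twist_d_der twist_h_deg twist_d_sq twist_d_h.

End Twist.

Section Cohomology.
Variables (k : fieldType) (B : gradedAlg k) (Psi : cdg B).
Local Notation d := (cdg_d Psi).
Local Notation C := (Cquot B).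

Fact cdg_d_scomm a b : d (scomm a b) \in comm_space.
Proof.
have [S0 SL] := @comm_space_submod k B.
have SD (x y : B) : x \in comm_space -> y \in comm_space ->
    x + y \in comm_space.
  by move=> hx hy; have := SL 1 x y hx hy; rewrite scale1r.
have SZ c (x : B) : x \in comm_space -> c *: x \in comm_space.
  by move=> hx; have := SL c x 0 hx S0; rewrite addr0.
rewrite /scomm linear_sum; apply: (big_ind (fun x => x \in comm_space)) => //.
move=> i _; rewrite linear_sum.
apply: (big_ind (fun x => x \in comm_space)) => // j _.
have hi : homog i (gr_pr i a) := homog_pr i a.
have hj : homog j (gr_pr j b) := homog_pr j b.
move: (gr_pr i a) (gr_pr j b) hi hj => x y hx hy.
suff -> : d (x * y - (-1) ^+ (i * j) *: (y * x)) =
    scomm (d x) y + (-1) ^+ i *: scomm x (d y).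
  by apply: SD; [|apply: SZ]; apply: comm_space_scomm.
rewrite linearB linearZ /= (cdg_d_der Psi _ hx) (cdg_d_der Psi _ hy).
rewrite (scommE (cdg_d_deg Psi hx) hy) (scommE hx (cdg_d_deg Psi hy)).
rewrite scalerBr !scalerDr !scalerA -!exprD mulSn mulnS.
have -> : ((-1) ^+ (i + (i + i * j)) : k) = (-1) ^+ (i * j).
  by rewrite addnA addnn exprD -[(-1) ^+ i.*2]signr_odd odd_double mul1r.
rewrite [(i * j + j)%N]addnC opprD.
by rewrite [RHS]addrACA; congr (_ + _); rewrite addrC.
Qed.

Fact cdg_d_comm_space b : b \in comm_space -> d b \in comm_space.
Proof.
have [S0 SL] := @comm_space_submod k B.
move=> /asboolP[s ->]; rewrite linear_sum.
apply: (big_ind (fun x => x \in comm_space)) => // [x y hx hy|p _].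
  by have := SL 1 x y hx hy; rewrite scale1r.
have := SL p.1.1 _ 0 (cdg_d_scomm p.1.2 p.2) S0.
by rewrite addr0 linearZ.
Qed.

(* Independent of the chosen representative: see deltaC_T. *)
Definition deltaC (x : C) : C := Tproj (d (quot_repr x)).

Lemma deltaC_T b : deltaC (Tproj b) = Tproj (d b).
Proof.
apply/quot_proj_eq; rewrite -linearB; apply: cdg_d_comm_space.
by apply/(quot_proj_eq (@comm_space_submod k B)); exact: quot_reprK.
Qed.

Lemma TprojK (x : C) : Tproj (quot_repr x) = x.
Proof. exact: quot_reprK. Qed.

Fact deltaC_is_linear : linear deltaC.
Proof.
move=> c x y; rewrite -(TprojK x) -(TprojK y).
by rewrite -linearP !deltaC_T !linearP.
Qed.
HB.instance Definition _ :=
  GRing.isLinear.Build k C C *:%R deltaC deltaC_is_linear.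

Lemma deltaC_sq x : deltaC (deltaC x) = 0.
Proof.
rewrite -(TprojK x) !deltaC_T cdg_d_sq -(linear0 (@Tproj k B)).
by apply/quot_proj_eq; rewrite subr0; apply: comm_space_scomm.
Qed.

Definition cocycle_pred (m : nat) : {pred C} := fun x =>
  `[< Cdeg m x /\ deltaC x = 0 >].

Fact cocycle_submod m : submod_closed (cocycle_pred m).
Proof.
split=> [|c x y /asboolP[hx dx] /asboolP[hy dy]]; apply/asboolP.
  by split; [exact: Cdeg0 | rewrite linear0].
by split; [exact: Cdeg_lin | rewrite linearP /= dx dy scaler0 addr0].
Qed.
HB.instance Definition _ m :=
  GRing.isSubmodClosed.Build k C (cocycle_pred m) (cocycle_submod m).

Record cocycle (m : nat) :=
  Cocycle { cocycle_val : C; cocycleP : cocycle_val \in cocycle_pred m }.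
HB.instance Definition _ m := [isSub for @cocycle_val m].
HB.instance Definition _ m := [Choice of cocycle m by <:].
HB.instance Definition _ m := [SubChoice_isSubLmodule of cocycle m by <:].

Definition cobound_pred (m : nat) : {pred cocycle m} := fun z =>
  `[< exists2 y : C, Cdeg_pred m y & deltaC y = val z >].

Fact cobound_submod m : submod_closed (@cobound_pred m).
Proof.
split=> [|c x y /asboolP[u hu ux] /asboolP[v hv vy]]; apply/asboolP.
  by exists 0; [exact: Cdeg_pred0 | rewrite !linear0].
by exists (c *: u + v); [exact: Cdeg_pred_lin | rewrite !linearP /= ux vy].
Qed.

Definition cohom (m : nat) : Type := quotmod (cobound_submod m).
HB.instance Definition _ m := GRing.Lmodule.on (cohom m).

Definition cohom_class m (z : cocycle m) : cohom m :=
  quot_proj (cobound_submod m) z.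

End Cohomology.

Definition chern (k : fieldType) (B : gradedAlg k) (Psi : cdg B) (n : nat) :
  Cquot B := Tproj (cdg_h Psi ^+ n).

Lemma deltaC_twist (k : fieldType) (B : gradedAlg k) (Psi : cdg B) (alpha : B)
  (alpha1 : homog 1 alpha) : deltaC (twist Psi alpha1) =1 deltaC Psi.
Proof.
move=> x; apply/quot_proj_eq; rewrite /= addrAC subrr add0r.
exact: comm_space_scomm.
Qed.

(* Main.v *)
Require Import Defs.
From HB Require Import structures.
From mathcomp Require Import all_boot all_order all_algebra.
From mathcomp Require Import boolp.

Set Implicit Arguments.
Unset Strict Implicit.
Unset Printing Implicit Defensive.

Import GRing.Theory.
Local Open Scope ring_scope.

(** Along the path h_t = h_0 + t (delta_0 alpha) + t^2 alpha^2 of curvatures of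
the twists by t alpha one has h_t' = delta_t alpha and delta_t h_t = 0, where
delta_t = delta_0 + [t alpha, .].  By cyclicity of T,
    d/dt T(h_t^(m+1)) = (m+1) T(delta_t (alpha h_t^m))
                      = (m+1) delta_C T(alpha h_t^m),
and in characteristic 0 this identity of polynomials in t can be integrated
coefficientwise from 0 to 1. *)

(** * Transgression along the curvature path, in an abstract ring *)

Section Transgression.

(* [S m] plays the role of B^(2m). *)
Variables (R : nzRingType) (V : zmodType) (S : nat -> R -> Prop).
Variables (T : {additive R -> V}) (d : {additive R -> R}) (h a : R).
Hypothesis S0 : forall m, S m 0.
Hypothesis S1 : S 0 1.
Hypothesis SD : forall m x y, S m x -> S m y -> S m (x + y).
Hypothesis SM : forall m n x y, S m x -> S n y -> S (m + n) (x * y).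
Hypothesis T_cyclic : forall m n x y, S m x -> S n y -> T (x * y) = T (y * x).
Hypothesis T_odd : forall m x, S m x -> T (a * (x * a)) = - T (a * a * x).
Hypothesis d_even : forall m x y, S m x -> d (x * y) = d x * y + x * d y.
Hypothesis d_odd : forall x, d (a * x) = d a * x - a * d x.
Hypothesis d_h : d h = 0.
Hypothesis d_da : d (d a) = h * a - a * h.
Hypothesis Sh : S 1 h.
Hypothesis Sda : S 1 (d a).
Hypothesis Saa : S 1 (a * a).

Definition curv_path : {poly R} :=
  h%:P + (d a)%:P * 'X + (a * a)%:P * 'X^2.

Local Notation p := curv_path.
Local Notation polyS m q := (forall i, S m (q : {poly R})`_i).

Lemma coef_curv_path i : p`_i =
  if i == 0 then h else if i == 1 then d a else if i == 2 then a * a else 0.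
Proof.
rewrite /p !coefD coefC coefMX coefMXn !coefC.
by case: i => [|[|[|i]]] //=; rewrite ?(addr0, add0r).
Qed.

Lemma polyS_curv_path : polyS 1 p.
Proof. by move=> i; rewrite coef_curv_path; do 3?case: ifP => _. Qed.

Lemma S_sum m (I : Type) (r : seq I) F : (forall i, S m (F i)) ->
  S m (\sum_(i <- r) F i).
Proof. by move=> SF; apply: (big_ind (S m)) => //; apply: SD. Qed.

Lemma polySM m n q r : polyS m q -> polyS n r -> polyS (m + n) (q * r).
Proof. by move=> Sq Sr i; rewrite coefM; apply: S_sum => j; apply: SM. Qed.

Lemma polySX m : polyS m (p ^+ m).
Proof.
elim: m => [i|m IH]; first by rewrite expr0 coef1; case: (i == 0).
by rewrite exprS -add1n; apply: polySM => //; apply: polyS_curv_path.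
Qed.

Lemma polyS_deriv m q : polyS m q -> polyS m q^`().
Proof.
move=> Sq i; rewrite coef_deriv; move: q`_i.+1 (Sq i.+1) => x Sx.
by elim: i.+1 => [|n IH]; rewrite ?mulrS //; apply: SD.
Qed.

Lemma coef_cyclic m n q r i : polyS m q -> polyS n r ->
  T (q * r)`_i = T (r * q)`_i.
Proof.
move=> Sq Sr; rewrite coefM coefMr !raddf_sum /=.
by apply: eq_bigr => j _; apply: T_cyclic.
Qed.

(** The ordinary power rule survives noncommutativity under [T]: in each Leibniz term, cyclicity
    carries the factors left of the derivative over to its right. The extra [p ^+ s] absorbs the
    factors already moved, so that the induction on [r] closes. *)
Lemma deriv_curv_pathX r s i :
  T ((p ^+ r.+1)^`() * p ^+ s)`_i = T (p^`() * p ^+ (r + s))`_i *+ r.+1.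
Proof.
have Sp := polyS_curv_path.
elim: r s => [|r IH] s; first by rewrite expr1.
rewrite exprS derivM mulrDl coefD raddfD /= -mulrA -exprD.
rewrite -(mulrA p) (coef_cyclic (n := r.+1 + s) _ Sp); last first.
  by apply: polySM; [apply: polyS_deriv|]; apply: polySX.
by rewrite -mulrA -exprSr IH addSnnS -mulrS.
Qed.

Local Notation D := (map_poly d).

Lemma coef_D q i : (D q)`_i = d q`_i.
Proof. by rewrite coef_map_id0 ?raddf0. Qed.

Lemma DM m q r : polyS m q -> D (q * r) = D q * r + q * D r.
Proof.
move=> Sq; apply/polyP => i; rewrite coef_D coefD !coefM raddf_sum -big_split /=.
by apply: eq_bigr => j _; rewrite !coef_D (d_even _ (Sq _)).
Qed.

(* The Bianchi identity delta_t h_t = 0. *)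
Lemma D_curv_path : D p = (p * a%:P - a%:P * p) * 'X.
Proof.
apply/polyP => i; rewrite coef_D coefMX coefB coefMC coefCM !coef_curv_path.
case: i => [|[|[|[|i]]]] //=; rewrite ?d_h ?d_da ?d_odd ?raddf0 //.
  by rewrite mulrA subrr.
by rewrite mul0r mulr0 subrr.
Qed.

(** The derivation [delta_t] kills [h_t], hence its powers; this is that fact with the commutator
    term moved to the right-hand side. *)
Lemma D_curv_pathX m : D (p ^+ m) = (p ^+ m * a%:P - a%:P * p ^+ m) * 'X.
Proof.
elim: m => [|m IH].
  rewrite expr0 mul1r mulr1 subrr mul0r.
  apply/polyP => i; rewrite coef_D coef0 coef1.
  case: (i == 0); last by rewrite raddf0.
  (* Here [d 1 = 0] comes from the Leibniz rule on [1 * 1]. *)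
  apply: (addIr (d 1)); rewrite add0r -[in RHS](mulr1 1).
  by rewrite (d_even 1 S1) mul1r mulr1.
rewrite exprS (DM _ polyS_curv_path) IH D_curv_path.
rewrite -[_ * 'X * _]mulrA -commr_polyX !mulrA -mulrDl; congr (_ * 'X).
by rewrite mulrBl mulrBr !mulrA addrC subrKA.
Qed.

(** Expanding [d (a * p ^+ m)] gives [d a * p ^+ m] plus ['X] times
    [a * a * p ^+ m - a * p ^+ m * a]. By [T_odd] the two terms of this difference have the same
    image under [T], which yields the coefficient [a * a *+ 2] of the derivative of [p]. *)
Lemma transgression_coef m i :
  T (p ^+ m.+1)`_i.+1 *+ i.+1 = T (d (a * (p ^+ m)`_i)) *+ m.+1.
Proof.
have := deriv_curv_pathX m 0 i.
rewrite expr0 mulr1 addn0 coef_deriv raddfMn /= => ->; congr (_ *+ _).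
rewrite d_odd -coef_D D_curv_pathX.
have -> : p^`() = (d a)%:P + (a * a *+ 2)%:P * 'X.
  apply/polyP => j; rewrite coef_deriv coefD coefC coefMX coefC coef_curv_path.
  by case: j => [|[|j]] //=; rewrite ?addr0 ?add0r ?mul0rn.
rewrite mulrDl coefD coefCM -mulrA -commr_polyX mulrA !coefMX coefCM.
case: i => [|i] /=; first by rewrite mulr0 subr0 addr0.
rewrite coefB coefMC coefCM mulrBr !raddfB /= raddfD /=.
rewrite (T_odd (polySX m i)) mulrnAl raddfMn /= !opprK.
by rewrite mulrA mulr2n.
Qed.

(** Since [V] is only an abelian group, the factors [i.+1] produced by differentiation stay as
    multiples; dividing by them is left to the field case. *)
Lemma transgression m : exists (N : nat) (c : nat -> R) (u : nat -> V),
  [/\ forall i, S m (c i),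
      forall i, u i *+ i.+1 = T (d (a * c i)) *+ m.+1
    & T ((h + d a + a * a) ^+ m.+1) - T (h ^+ m.+1) = \sum_(i < N) u i].
Proof.
exists (size (p ^+ m.+1)), (fun i => (p ^+ m)`_i), (fun i => T (p ^+ m.+1)`_i.+1).
split; [exact: polySX | exact: transgression_coef |].
have <- : p.[1] = h + d a + a * a.
  by rewrite /p !hornerE hornerXn expr1n mulr1.
have <- : p.[0] = h by rewrite horner_coef0 coef_curv_path.
(* Evaluation commutes with powers at 0 and 1 because these points are central. *)
rewrite -!horner_exp_comm /comm_poly ?mul0r ?mulr0 ?mul1r ?mulr1 //.
(* Padding the sum by one term leaves exactly [N] terms once the constant one, which is the value at
   0, is split off. *)
rewrite horner_coef0 (@horner_coef_wide _ (size (p ^+ m.+1)).+1) //.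
rewrite big_ord_recl expr0 mulr1 raddfD /= addrAC subrr add0r raddf_sum.
by apply: eq_bigr => i _; rewrite expr1n mulr1.
Qed.

End Transgression.

(** * Chern classes of CDG-algebras *)

Section CdgChern.
Variables (k : fieldType) (B : gradedAlg k).

Lemma Tproj_scomm (a b : B) : Tproj (scomm a b) = 0.
Proof.
rewrite -(linear0 (@Tproj k B)); apply/quot_proj_eq; rewrite subr0.
exact: comm_space_scomm.
Qed.

Lemma Tproj_comm i j (a b : B) : homog i a -> homog j b ->
  Tproj (a * b) = (-1) ^+ (i * j) *: Tproj (b * a).
Proof.
move=> ha hb; apply/eqP; rewrite -subr_eq0 -linearZ -linearB /=.
by rewrite -(scommE ha hb) Tproj_scomm.
Qed.

Lemma sign_even m : (-1) ^+ (2 * m) = 1 :> k.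
Proof. by rewrite exprM sqrrN expr1n expr1n. Qed.

Lemma homogX i (b : B) m : homog i b -> homog (i * m) (b ^+ m).
Proof.
move=> hb; elim: m => [|m IH]; first by rewrite muln0; apply: gr_one_deg.
by rewrite exprS mulnS; apply: homogM.
Qed.

Variable Psi : cdg B.
Local Notation d := (cdg_d Psi).
Local Notation h := (cdg_h Psi).

Lemma chern_deg n : Cdeg (2 * n) (chern Psi n).
Proof. by exists (h ^+ n) => //; apply/homogX/cdg_h_deg. Qed.

Lemma cdg_d_even m (x y : B) : homog (2 * m) x -> d (x * y) = d x * y + x * d y.
Proof. by move=> hx; rewrite (cdg_d_der _ _ hx) sign_even scale1r. Qed.

Lemma cdg_d1 : d 1 = 0.
Proof.
have := @cdg_d_even 0 1 1 (gr_one_deg B); rewrite !mul1r mulr1 => d1.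
by apply: (addIr (d 1)); rewrite add0r -d1.
Qed.

Lemma cdg_d_hX n : d (h ^+ n) = 0.
Proof.
elim: n => [|n IH]; first exact: cdg_d1.
by rewrite exprS (@cdg_d_even 1 _ _ (cdg_h_deg Psi)) cdg_d_h IH mul0r mulr0 addr0.
Qed.

Lemma chern_closed n : deltaC Psi (chern Psi n) = 0.
Proof. by rewrite deltaC_T cdg_d_hX linear0. Qed.

Lemma cdg_transgression (alpha : B) (alpha1 : homog 1 alpha) m :
  exists (N : nat) (c : nat -> B) (u : nat -> Cquot B),
  [/\ forall i, homog (2 * m) (c i),
      forall i, u i *+ i.+1 = Tproj (d (alpha * c i)) *+ m.+1
    & chern (twist Psi alpha1) m.+1 - chern Psi m.+1 = \sum_(i < N) u i].
Proof.
(* [{poly R}] requires a nontrivial ring, so the zero algebra is apart. *)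
have [B0|B_nz] := eqVneq (1 : B) 0.
  have b0 (b : B) : b = 0 by rewrite -[b]mul1r B0 mul0r.
  exists 0, (fun=> 0), (fun=> 0); split=> [i|i|]; first exact: homog0.
    by rewrite (b0 (d _)) linear0 !mul0rn.
  by rewrite big_ord0 /chern (b0 (_ ^+ _)) (b0 (h ^+ _)) subrr.
have haa : homog 2 (alpha * alpha) := homogM alpha1 alpha1.
have T_cyclic i j (x y : B) : homog (2 * i) x -> homog (2 * j) y ->
    Tproj (x * y) = Tproj (y * x).
  by move=> hx hy; rewrite (Tproj_comm hx hy) -mulnA sign_even scale1r.
have T_odd i (x : B) : homog (2 * i) x ->
    Tproj (alpha * (x * alpha)) = - Tproj (alpha * alpha * x).
  (* Both [alpha] and [x * alpha] are odd, whence the sign; even cyclicity then brings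
     [alpha * alpha] to the front. *)
  move=> hx; rewrite (Tproj_comm alpha1 (homogM hx alpha1)) mul1n addn1 exprS.
  by rewrite sign_even mulr1 scaleN1r -mulrA (T_cyclic i 1).
have d_odd (x : B) : d (alpha * x) = d alpha * x - alpha * d x.
  by rewrite (cdg_d_der _ _ alpha1) expr1 scaleN1r.
have d_da : d (d alpha) = h * alpha - alpha * h.
  by rewrite cdg_d_sq (scommE (cdg_h_deg Psi) alpha1) muln1 sqrrN expr1n scale1r.
have hM i j (x y : B) : homog (2 * i) x -> homog (2 * j) y ->
    homog (2 * (i + j)) (x * y).
  by rewrite mulnDr; apply: homogM.
pose R : nzRingType := HB.pack (gr_sort B)
  (GRing.PzSemiRing_isNonZero.Build (gr_sort B) B_nz).
exact: (@transgression R (Cquot B) (fun i => @homog k B (2 * i)) Tproj d h alpha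
  (fun i => homog0 B (2 * i)) (gr_one_deg B) (fun i => @homogD k B (2 * i)) hM
  T_cyclic T_odd cdg_d_even d_odd (cdg_d_h Psi) d_da (cdg_h_deg Psi)
  (cdg_d_deg Psi alpha1) haa).
Qed.

Lemma chern_twist_cobound (char0 : [pchar k] =i pred0) (alpha : B)
  (alpha1 : homog 1 alpha) m :
  exists2 y, Cdeg_pred (2 * m.+1) y
    & deltaC Psi y = chern (twist Psi alpha1) m.+1 - chern Psi m.+1.
Proof.
have [N [c [u [hc hu ->]]]] := cdg_transgression alpha1 m.
(* The denominator integrates [t^i] over [[0, 1]]; the numerator is the factor of the power rule. *)
pose y i := (m.+1%:R / i.+1%:R : k) *: Tproj (alpha * c i).
exists (\sum_(i < N) y i).
  apply: (big_ind (Cdeg_pred (2 * m.+1))) => [|v w hv hw|i _].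
  - exact: Cdeg_pred0.
  - by rewrite -[v]scale1r; apply: Cdeg_pred_lin.
  rewrite mulnS /y -[_ *: _]addr0; apply: Cdeg_pred_lin; last exact: Cdeg_pred0.
  by exists (alpha * c i) => //; apply: homogM.
rewrite linear_sum; apply: eq_bigr => i _.
(* Characteristic 0 makes the integration possible. *)
have i_neq0 : i.+1%:R != 0 :> k by rewrite ((pcharf0P k).1 char0).
rewrite linearZ /= deltaC_T mulrC -scalerA scaler_nat -hu -scaler_nat scalerA.
by rewrite mulVf // scale1r.
Qed.

End CdgChern.

Theorem mainTheorem11 (k : fieldType) (char0 : [pchar k] =i pred0)
    (B : gradedAlg k) (Psi0 : cdg B) (n : nat) (n_gt0 : (0 < n)%N) :
  [/\ Cdeg (2 * n) (chern Psi0 n),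
      deltaC Psi0 (chern Psi0 n) = 0
    & forall (alpha : B) (alpha1 : homog 1 alpha),
      exists (z0 : chern Psi0 n \in cocycle_pred Psi0 (2 * n))
             (z1 : chern (twist Psi0 alpha1) n \in cocycle_pred Psi0 (2 * n)),
        cohom_class (Cocycle z0) = cohom_class (Cocycle z1)].
Proof.
split=> [||alpha alpha1]; [exact: chern_deg | exact: chern_closed |].
have z0 : chern Psi0 n \in cocycle_pred Psi0 (2 * n).
  by apply/asboolP; split; [exact: chern_deg | exact: chern_closed].
have z1 : chern (twist Psi0 alpha1) n \in cocycle_pred Psi0 (2 * n).
  apply/asboolP; split; first exact: chern_deg.
  (* The twisted class is closed for its own differential, which agrees with that of [Psi0] on
     [C]. *)
  by rewrite -(deltaC_twist Psi0 alpha1) chern_closed.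
(* The sides are swapped because the coboundary is the twisted class minus the original one. *)
exists z0, z1; apply/esym/quot_proj_eq/asboolP.
case: n n_gt0 z0 z1 => // m _ z0 z1; exact: chern_twist_cobound.
Qed.
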